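(* Let $b,r_1,r_2$ be real numbers with $$b>0,\quad r_1,r_2>\tfrac12,\quad r_1+r_2<3,\quad r_1+1<3r_2,\quad r_2+1<3r_1,\quad b<\frac{2}{3+r_1+r_2},$$ and for $t\ge2$ set $$\Omega(t):=\{(x,y,z)\in\mathbb{R}^3 : |x|<t^b,\ |y|<t^{br_1},\ |z|<t^{br_2}\}.$$ Let $u_0\in H^1(\mathbb{R}^3)$ and let $u=u(x,y,z,t)$, $u\in C(\mathbb{R}:H^1(\mathbb{R}^3))$, be the solution of the three-dimensional Zakharov-Kuznetsov equation $\partial_tu+\partial_x\Delta u+u\,\partial_xu=0$ with $u(0)=u_0$. Then $$\liminf_{t\to\infty}\int_{\Omega(t)}u^2(x,y,z,t)\,dx\,dy\,dz=0.$$
   Context: Here $u$ is real valued, $\Delta=\partial_x^2+\partial_y^2+\partial_z^2$. The 3D Zakharov-Kuznetsov equation is globally well-posed in $H^1(\mathbb{R}^3)$ (a known result); ''the solution'' is the unique global one given by that theory. It conserves the $L^2$ norm and its $H^1$ norm is bounded uniformly in time. *)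

(* Defs.v *)
From mathcomp Require Import all_boot all_order all_algebra.
From mathcomp Require Import all_classical all_reals all_analysis.
Set Implicit Arguments.
Unset Strict Implicit.
Unset Printing Implicit Defensive.
Import Order.TTheory GRing.Theory Num.Theory.
Import numFieldNormedType.Exports.
Local Open Scope classical_set_scope.
Local Open Scope ring_scope.

(* A point (x, y, z) of R^3 is x = p.1.1, y = p.1.2, z = p.2. *)
Notation R3 R := (R * R * R)%type.

Section ZakharovKuznetsov.
Variable R : realType.
Implicit Types (f g phi : R3 R -> R) (u : R -> R3 R -> R).

(* Lebesgue measure on the Borel sets of R^3. *)
Definition leb3 : {measure set _ -> \bar R} :=
  ((@lebesgue_measure R \x @lebesgue_measure R) \x @lebesgue_measure R)%E.

Definition basis3 (i : 'I_3) : R3 R :=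
  ((i == 0%N :> nat)%:R, (i == 1%N :> nat)%:R, (i == 2%N :> nat)%:R).

(* Coordinates are numbered 0 (x), 1 (y), 2 (z). *)
Definition partial (i : 'I_3) f : R3 R -> R := fun p => 'D_(basis3 i) f p.

Definition laplacian f : R3 R -> R :=
  fun p => \sum_(i < 3) partial i (partial i f) p.

(* Every iterated partial derivative, in any order, exists and is continuous. *)
Definition smooth f : Prop :=
  forall w : seq 'I_3, let h := foldr partial f w in
    continuous h /\ forall i p, derivable h p (basis3 i).

Definition test_function phi : Prop :=
  smooth phi /\ compact (closure [set p | phi p != 0]).

Definition weak_partial (i : 'I_3) f g : Prop :=
  forall phi, test_function phi ->
    \int[leb3]_p (f p * partial i phi p) = - \int[leb3]_p (g p * phi p).

Definition inL2 f : Prop := f \in Lfun leb3 2%:E.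

Definition inH1 f : Prop :=
  inL2 f /\ forall i, exists2 g, inL2 g & weak_partial i f g.

(* The weak derivative is determined up to a null set; for f outside H^1 the
   value (a default, possibly 0) is irrelevant. *)
Definition weakD (i : 'I_3) f : R3 R -> R :=
  xget (cst 0) [set g | inL2 g /\ weak_partial i f g].

Definition L2norm f : \bar R := ('N[leb3]_2%:E[EFin \o f])%E.

Definition H1norm f : \bar R :=
  ((L2norm f ^+ 2 + \sum_(i < 3) L2norm (weakD i f) ^+ 2) `^ 2^-1)%E.

(* u is in C(R : H^1(R^3)). *)
Definition continuous_in_H1 u : Prop :=
  (forall t, inH1 (u t)) /\
  (forall t, H1norm (u s \- u t) @[s --> t] --> 0%E).

(* d_t u + d_x Delta u + u d_x u = 0, tested against functions of the space
   variables, with u d_x u = d_x (u^2 / 2): for u in C(R : H^1) this is the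
   equation in the sense of distributions on R x R^3. *)
Definition ZK_equation u : Prop :=
  forall phi, test_function phi -> forall t : R,
    is_derive t 1 (fun s => \int[leb3]_p (u s p * phi p))
      (\int[leb3]_p (u t p * partial ord0 (laplacian phi) p)
       + 2^-1 * \int[leb3]_p (u t p ^+ 2 * partial ord0 phi p)).

(* The global solution provided by the well-posedness theory in H^1(R^3),
   with the properties which that theory gives: conservation of the L^2 norm
   and a bound on the H^1 norm uniform in time. *)
Record ZK_solution (u0 : R3 R -> R) u : Prop := {
  ZK_continuous : continuous_in_H1 u ;
  ZK_initial : {ae leb3, forall p, u 0 p = u0 p} ;
  ZK_eq : ZK_equation u ;
  ZK_mass : forall t, L2norm (u t) = L2norm u0 ;
  ZK_bounded : exists M : R, forall t, (H1norm (u t) <= M%:E)%E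
}.

Definition Omega (b r1 r2 t : R) : set (R3 R) :=
  [set p | [/\ `|p.1.1| < t `^ b, `|p.1.2| < t `^ (b * r1)
             & `|p.2| < t `^ (b * r2)]].

End ZakharovKuznetsov.

(* Main.v *)
Require Import Defs.
From mathcomp Require Import all_boot all_order all_algebra.
From mathcomp Require Import all_classical all_reals all_analysis.
From mathcomp Require Import measurable_realfun ring lra.
Import Order.TTheory GRing.Theory Num.Theory.
Import numFieldNormedType.Exports.
Local Open Scope classical_set_scope.
Local Open Scope ring_scope.

(** For a fixed test function phi, the equation gives
      d/dt int u phi = int u d_x Delta phi + (1/2) int u^2 d_x phi.
    If the local mass stayed above some c > 0, apply this on the time interval
    [T, 2T] with phi(x, y, z) = psi(x/L1) rho(y/L2) rho(z/L3), where L1, L2, L3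
    are the sides of Omega(2T), psi' >= m on [-1, 1] and psi' >= - e everywhere.
    By the mean value theorem, at some time t of the interval, with M the
    conserved mass and l = (L1 L2 L3)^(1/2),
      m c <= e M + K l (L1/T + L1^-2 + L2^-2 + L3^-2).
    The conditions on b, r1, r2 are those which make the last term tend to 0.
    The fixed test function and the pointwise mean value theorem avoid any
    differentiation of a time-dependent weight and any integral in time. *)

(** * Smooth functions of one real variable and the flat function exp(-1/x) *)

Section SmoothFunctions1D.
Context {R : realType}.
Implicit Types (f g : R -> R) (k n : nat) (a c x : R).

(** This is [k]-fold differentiability, with no continuity asked of the last derivative; the
    difference disappears in [smooth1], where all [k] are required. *)
Fixpoint Ck k f : Prop :=
  if k is k'.+1 then (forall x, derivable f x 1) /\ Ck k' (derive1 f) else True.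

Definition smooth1 f := forall k, Ck k f.

(** Lets a closed formula stand for [derive1 f], so that each closure property becomes an induction
    on [k] with an explicit derivative. *)
Lemma Ck_is_derive k f df :
  (forall x, is_derive x 1 f (df x)) -> Ck k df -> Ck k.+1 f.
Proof.
move=> fdf dfk; split => [x|]; first by have [] := fdf x.
suff -> : derive1 f = df by [].
by apply/funext => x; rewrite derive1E; have [_ ->] := fdf x.
Qed.

Lemma CkW k f : Ck k.+1 f -> Ck k f.
Proof.
by elim: k f => [//|k IH] f [df dfk]; split=> //; exact: IH.
Qed.

Lemma is_derive_derive1 f x : derivable f x 1 -> is_derive x 1 f (derive1 f x).
Proof. by rewrite derive1E; exact: derivableP. Qed.

Lemma Ck_cst k c : Ck k (cst c).
Proof.
elim: k c => [//|k IH] c; apply: (@Ck_is_derive _ _ (cst 0)) => // x.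
Qed.

Lemma CkD k f g : Ck k f -> Ck k g -> Ck k (f + g).
Proof.
elim: k f g => [//|k IH] f g [df fk] [dg gk].
apply: (@Ck_is_derive _ _ (derive1 f + derive1 g)); last exact: IH.
by move=> x; apply: is_deriveD; exact: is_derive_derive1.
Qed.

Lemma CkM k f g : Ck k f -> Ck k g -> Ck k (f * g).
Proof.
elim: k f g => [//|k IH] f g fk gk.
have [df f'k] := fk; have [dg g'k] := gk.
apply: (@Ck_is_derive _ _ (f * derive1 g + g * derive1 f)).
  by move=> x; apply: is_deriveM; exact: is_derive_derive1.
by apply: CkD; apply: IH => //; exact: CkW.
Qed.

Lemma is_derive_affine f a c x df : is_derive (a * x + c) 1 f df ->
  is_derive x 1 (fun y => f (a * y + c)) (a * df).
Proof.
move=> fd; have ha : is_derive x 1 (fun y => a * y + c : R) a.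
  have -> : (fun y => a * y + c) = (a \*: id) + cst c by exact/funext.
  by apply: is_derive_eq; rewrite addr0 /GRing.scale/= mulr1.
by rewrite mulrC; apply: (@is_derive1_comp _ f (fun y => a * y + c)).
Qed.

Lemma Ck_affine k f a c : Ck k f -> Ck k (fun x => f (a * x + c)).
Proof.
elim: k f => [//|k IH] f [df fk].
apply: (@Ck_is_derive _ _ (cst a * (fun x => derive1 f (a * x + c)))).
  by move=> x; apply: is_derive_affine; exact: is_derive_derive1.
by apply: CkM; [exact: Ck_cst|exact: IH].
Qed.

Lemma smooth1_derivable f x : smooth1 f -> derivable f x 1.
Proof. by move=> /(_ 1%N)[]. Qed.

Lemma smooth1_derive1 f : smooth1 f -> smooth1 (derive1 f).
Proof. by move=> sf k; have [] := sf k.+1. Qed.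

Lemma smooth1_derive1n n f : smooth1 f -> smooth1 (derive1n n f).
Proof. by move=> sf; elim: n => [//|n IH]; exact: smooth1_derive1. Qed.

Lemma smooth1_continuous f : smooth1 f -> continuous f.
Proof.
move=> sf x; apply: differentiable_continuous.
exact/derivable1_diffP/smooth1_derivable.
Qed.

(* The family is stable under differentiation up to linear combinations, and
   its first member is the standard flat function exp(-1/x). *)
Definition flat n x : R := if 0 < x then x^-1 ^+ n * expR (- x^-1) else 0.

Lemma flat_ge0 n x : 0 <= flat n x.
Proof.
rewrite /flat; case: ifP => // x0; rewrite mulr_ge0 ?expR_ge0//.
by rewrite exprn_ge0// invr_ge0 ltW.
Qed.

(** With y = 1/x this is y^n exp(-y) <= n!, which follows from exp(y) >= 1 + y^n / n! for n > 0. *)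
Lemma flat_le n x : flat n x <= n`!%:R.
Proof.
rewrite /flat; case: ifP => // x0.
rewrite expRN ler_pdivrMr ?expR_gt0//.
have y0 : 0 <= x^-1 by rewrite invr_ge0 ltW.
case: n => [|n]; first by rewrite expr0 mul1r -expR0 ler_expR.
have := expR_ge1Dxn n y0.
have f0 : 0 < n.+1`!%:R :> R by rewrite ltr0n fact_gt0.
move=> h; rewrite mulrC -ler_pdivrMr//; apply: le_trans h.
by rewrite lerDr.
Qed.

(** Extracts a factor x^2, which makes the difference quotient at 0 vanish in the limit. *)
Lemma flatE n x : flat n x = x ^+ 2 * flat n.+2 x.
Proof.
rewrite /flat; case: ifP => x0; last by rewrite mulr0.
rewrite mulrA -[n.+2]addn2 exprD [_ * x^-1 ^+ 2]mulrC mulrA -exprMn.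
by rewrite mulfV ?gt_eqF// expr1n mul1r.
Qed.

Lemma is_derive_flat n x :
  is_derive x 1 (flat n) (flat n.+2 x - n%:R * flat n.+1 x).
Proof.
have [x0|x0|->] := ltgtP x 0.
- apply: (@near_eq_is_derive _ _ _ (cst 0)).
    near=> y; rewrite /flat; case: ifP => // y0.
    have : y < 0 by near: y; exact: lt_nbhsl.
    by rewrite ltNge ltW.
  by rewrite /flat ltNge (ltW x0)/= mulr0 subr0; exact: is_derive_cst.
- apply: (@near_eq_is_derive _ _ _ (fun x => x^-1 ^+ n * expR (- x^-1))).
    near=> y; rewrite /flat; case: ifP => // /negP[].
    by near: y; exact: lt_nbhsr.
  have xn0 : x != 0 by rewrite gt_eqF.
  have dV : is_derive x 1 (fun y : R => y^-1) (- x ^- 2).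
    have -> : - x ^- 2 = - x ^- 2 *: (1 : R) by rewrite /GRing.scale/= mulr1.
    exact: (@is_deriveV _ id).
  have dE : is_derive x 1 (fun y : R => expR (- y^-1)) (expR (- x^-1) * x ^- 2).
    have -> : x ^- 2 = - - x ^- 2 by rewrite opprK.
    apply: (@is_derive1_comp _ expR (fun y => - y^-1)).
  have dX := @is_deriveX _ _ (fun y : R => y^-1) n x 1 _ dV.
  have -> : (fun y => y^-1 ^+ n * expR (- y^-1)) =
      ((fun y : R => y^-1) ^+ n) * (fun y : R => expR (- y^-1)).
    by apply/funext => y; rewrite !fctE.
  apply: (is_derive_eq (is_deriveM dX dE)); rewrite /flat x0 /GRing.scale/= /=.
  rewrite exprfctE /=.
  (* The power rule involves the exponent n - 1, so n = 0 is treated apart. *)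
  rewrite -exprVn; case: n {dX} => [|n] /=.
    by rewrite !expr0 !mul0r mulr0 addr0 mul1r subr0 mulrC.
  rewrite !exprS; ring.
- rewrite {2 3}/flat ltxx mulr0 subr0.
  have flat0 : flat n 0 = 0 by rewrite /flat ltxx.
  have lim0 : h^-1 *: ((flat n \o shift 0) (h *: 1) - flat n 0) @[h --> 0^'] --> (0 : R).
    apply/cvgrPdist_le => e e0.
    have C0 : 0 < n.+2`!%:R :> R by rewrite ltr0n fact_gt0.
    near=> h.
    have h0 : h != 0 by near: h; exact: nbhs_dnbhs_neq.
    (* By [flatE] the quotient is [h * flat n.+2 h], which [flat_le] bounds by |h| (n+2)!. *)
    rewrite flat0 /= subr0 addr0 sub0r normrN /GRing.scale/= mulr1 flatE.
    rewrite expr2 mulrA mulKf// normrM.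
    rewrite [X in _ * X]ger0_norm ?flat_ge0//.
    apply: (@le_trans _ _ (`|h| * n.+2`!%:R)); first by rewrite ler_wpM2l ?flat_le.
    rewrite -ler_pdivlMr//.
    near: h; apply: dnbhs0_le; exact: divr_gt0.
  apply: DeriveDef; first by apply/cvg_ex; exists 0.
  exact/cvg_lim.
Unshelve. all: end_near.
Qed.

Lemma smooth1_flat n : smooth1 (flat n).
Proof.
move=> k; elim: k n => [//|k IH] n; apply: Ck_is_derive (is_derive_flat n) _.
have -> : (fun x => flat n.+2 x - n%:R * flat n.+1 x) =
    flat n.+2 + cst (- n%:R) * flat n.+1.
  by apply/funext => x /=; rewrite mulNr.
by apply: CkD; [exact: IH|apply: CkM; [exact: Ck_cst|exact: IH]].
Qed.

(** The strict inequality defines an open set, so [f] coincides with 0 near each of its points. *)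
Lemma derive1_eq0_outside (f : R -> R) A :
  (forall x, A < `|x| -> f x = 0) -> forall x, A < `|x| -> derive1 f x = 0.
Proof.
move=> f0 x Ax; rewrite derive1E (@near_eq_derive _ _ _ _ (cst 0)) ?derive_cst//.
near=> y; apply: f0; near: y.
have /(_ x) : continuous (@Num.norm R R) by exact: norm_continuous.
by move=> /(_ _ (lt_nbhsr Ax)).
Unshelve. all: end_near.
Qed.

Lemma derive1n_eq0_outside n (f : R -> R) A :
  (forall x, A < `|x| -> f x = 0) -> forall x, A < `|x| -> derive1n n f x = 0.
Proof. by move=> f0; elim: n => [//|n IH]; exact: derive1_eq0_outside. Qed.

Lemma bounded_of_eq0_outside (f : R -> R) A : 0 <= A -> continuous f ->
  (forall x, A < `|x| -> f x = 0) -> exists2 M, 0 <= M & forall x, `|f x| <= M.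
Proof.
move=> A0 cf f0.
have AA : - A <= A by rewrite (le_trans _ A0)// oppr_le0.
have [c _ fc] := @EVT_max R (fun x => `|f x|) (- A) A AA
  (continuous_subspaceT (fun x => cvg_norm (cf x))).
exists `|f c| => // x; have [xA|/f0 ->] := leP `|x| A; last by rewrite normr0.
by apply: fc; rewrite in_itv/= -ler_norml.
Qed.

End SmoothFunctions1D.

(** * The bump function and the slowly returning increasing profile *)

Section Profiles.
Context {R : realType}.
Implicit Types (f g : R -> R) (A a x : R).

Lemma smooth1M f g : smooth1 f -> smooth1 g -> smooth1 (f * g).
Proof. by move=> sf sg k; exact: CkM. Qed.

Lemma smooth1_affine f a c : smooth1 f -> smooth1 (fun x => f (a * x + c)).
Proof. by move=> sf k; exact: Ck_affine. Qed.

Lemma smooth1_scale f a : smooth1 f -> smooth1 (fun x => f (a * x)).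
Proof.
by move=> /(smooth1_affine _ a 0); under eq_fun do rewrite addr0.
Qed.

Lemma derive1_scale f a : smooth1 f ->
  derive1 (fun x => f (a * x)) = (fun x => a * derive1 f (a * x)).
Proof.
move=> sf; apply/funext => x; rewrite derive1E.
have -> : (fun y => f (a * y)) = (fun y => f (a * y + 0)).
  by apply/funext => y; rewrite addr0.
have /is_derive_affine[_ ->] := is_derive_derive1 _ _
  (smooth1_derivable _ (a * x + 0) sf).
by rewrite addr0.
Qed.

Lemma exists_bump : exists chi : R -> R,
  [/\ smooth1 chi, forall x, 0 <= chi x, forall x, 1 < `|x| -> chi x = 0 &
      exists2 m, 0 < m & forall x, `|x| <= 2^-1 -> m <= chi x].
Proof.
have flat_half y : 2^-1 <= y -> expR (- 2) <= flat 0 y.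
  move=> y2; have y0 : 0 < y by apply: lt_le_trans y2.
  by rewrite /flat y0 expr0 mul1r ler_expR lerN2 invf_ple// posrE.
(* One factor vanishes for x <= -1, the other for x >= 1. On [-1/2, 1/2] both arguments are at least
   1/2, so each factor is at least exp(-2). *)
exists ((fun x => flat 0 (1 * x + 1)) * (fun x => flat 0 (- 1 * x + 1))); split.
- by apply: smooth1M; apply: smooth1_affine; exact: smooth1_flat.
- by move=> x; rewrite mulr_ge0// flat_ge0.
- move=> x; rewrite lter_normr mulrfctE/= mul1r mulN1r => /orP[] x1.
    by rewrite [X in _ * X](_ : _ = 0) ?mulr0// /flat ifF//; apply/negbTE; lra.
  by rewrite [X in X * _](_ : _ = 0) ?mul0r// /flat ifF//; apply/negbTE; lra.
- exists (expR (- 2) * expR (- 2)); first by rewrite mulr_gt0 ?expR_gt0.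
  move=> x; rewrite ler_norml => /andP[x1 x2].
  by apply: ler_pM; rewrite ?expR_ge0//; apply: flat_half; lra.
Qed.

(* A slowly modulated increasing function: it climbs on [-1, 1] and comes back
   to 0 over an interval so long that its derivative stays above [- e]. *)
Lemma exists_profile : exists2 m : R, 0 < m & forall e, 0 < e ->
  exists psi : R -> R, exists2 A, 0 <= A &
    [/\ smooth1 psi, forall x, A < `|x| -> psi x = 0,
        forall x, `|x| <= 1 -> m - e <= derive1 psi x &
        forall x, - e <= derive1 psi x].
Proof.
have [chi [schi chi0 chi1 [m m0 mchi]]] := exists_bump.
have [S S0 chiS] := bounded_of_eq0_outside (derive1 chi) 1 ler01
  (smooth1_continuous _ (smooth1_derive1 _ schi)) (derive1_eq0_outside _ _ chi1).
(* On [-1, 1] the argument x + 2 lies in [1, 3], hence [flat 2 (x + 2)] is at least exp(-1) / 9. *)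
exists (9^-1 * expR (- 1) * m); first by rewrite !mulr_gt0 ?expR_gt0.
(* K >= 2 sends [-1, 1] into the interval where [chi] is at least [m]; K >= S / e makes the slope of
   [chi] after dilation by K at most [e]. *)
move=> e e0; pose K := 2 + S / e.
have K0 : 0 < K by rewrite ltr_wpDr// divr_ge0// ltW.
have SK : S * K^-1 <= e.
  by rewrite ler_pdivrMr// /K mulrDr [e * (S / e)]mulrC divfK ?gt_eqF// lerDr mulr_ge0// ltW.
pose psi := (fun x => flat 0 (1 * x + 2)) * (fun x => chi (K^-1 * x)) : R -> R.
have spsi : smooth1 psi.
  apply: smooth1M; first by apply: smooth1_affine; exact: smooth1_flat.
  exact: smooth1_scale.
have dpsi x : derive1 psi x = flat 2 (x + 2) * chi (K^-1 * x) +
    flat 0 (x + 2) * (K^-1 * derive1 chi (K^-1 * x)).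
  have d1 : is_derive x 1 (fun x => flat 0 (1 * x + 2)) (flat 2 (x + 2)).
    have := is_derive_affine _ 1 2 x _ (is_derive_flat 0 (1 * x + 2)).
    by rewrite mul0r subr0 !mul1r.
  have d2 := is_derive_derive1 _ _ (smooth1_derivable _ x (smooth1_scale _ K^-1 schi)).
  rewrite derive1_scale// in d2.
  rewrite derive1E; have [_ ->] := is_deriveM d1 d2.
  by rewrite /GRing.scale/= mul1r addrC [X in X + _]mulrC.
have second x : - e <= flat 0 (x + 2) * (K^-1 * derive1 chi (K^-1 * x)).
  rewrite lerNl -mulrN; apply: le_trans SK.
  have K1 : 0 <= K^-1 by rewrite invr_ge0 ltW.
  apply: (@le_trans _ _ (flat 0 (x + 2) * (S * K^-1))).
    rewrite ler_wpM2l ?flat_ge0// mulrC -mulNr ler_wpM2r//.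
    by rewrite (le_trans (ler_norm _))// normrN.
  rewrite ler_piMl// ?mulr_ge0//.
  (* At n = 0 the bound is 0! = 1. *)
  exact: flat_le.
exists psi, K; [exact: ltW|split => // x].
- move=> Kx; rewrite /psi mulrfctE/= chi1 ?mulr0// normrM.
  by rewrite gtr0_norm ?invr_gt0// mulrC ltr_pdivlMr// mul1r.
- rewrite ler_norml => /andP[x1 x2]; rewrite dpsi lerD//.
  apply: ler_pM; [by rewrite mulr_ge0 ?expR_ge0|exact: ltW| |].
        have x20 : 0 < x + 2 by lra.
    rewrite /flat x20 ler_pM ?expR_ge0//.
      rewrite exprVn lef_pV2 ?posrE ?exprn_gt0//.
      have -> : 9 = 3 ^+ 2 :> R by ring.
      by rewrite lerXn2r// ?nnegrE; lra.
    by rewrite ler_expR lerN2 invf_ple ?posrE// invr1; lra.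
  apply: mchi; rewrite normrM gtr0_norm ?invr_gt0//.
  rewrite mulrC ler_pdivrMr//.
  have K2 : 2 <= K by rewrite lerDl divr_ge0// ltW.
  have : `|x| <= 1 by rewrite ler_norml x1.
  lra.
- by rewrite dpsi -[- e]add0r lerD// mulr_ge0 ?flat_ge0.
Qed.

End Profiles.

(** * Tensor products of one-variable functions, their partial derivatives and supports *)

Section ProductFunctions.
Context {R : realType}.
Implicit Types (f g h : R -> R) (p v : R3 R).

Definition prod3 f g h : R3 R -> R := fun p => f p.1.1 * g p.1.2 * h p.2.

(** A directional derivative sees only the restriction to a line: both difference quotients are the
    same function of the parameter. *)
Lemma is_derive_line (F : R3 R -> R) (G : R -> R) p v (dG : R) :
  (forall t, F (t *: v + p) = G t) -> is_derive (0 : R) 1 G dG -> is_derive p v F dG.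
Proof.
move=> FG [dG1 <-].
have E : (fun t : R => t^-1 *: ((F \o shift p) (t *: v) - F p)) =
         (fun t : R => t^-1 *: ((G \o shift 0) (t *: 1) - G 0)).
  have Fp : F p = G 0 by rewrite -FG scale0r add0r.
  by apply/funext => t /=; rewrite FG Fp addr0 [t%:A]mulr1.
by split; rewrite /derivable /derive E.
Qed.

Lemma is_derive_prod3_0 f g h p : smooth1 f ->
  is_derive p (basis3 R ord0) (prod3 f g h) (prod3 (derive1 f) g h p).
Proof.
move=> sf; apply: (@is_derive_line _
  (cst (g p.1.2 * h p.2) * (fun t => f (1 * t + p.1.1)))).
  move=> t; rewrite /prod3 /basis3 mulrfctE/= !mul1r.
  by rewrite /GRing.scale/= !mulr1 !mulr0 !add0r -mulrA mulrC.
have d := is_derive_derive1 _ _ (smooth1_derivable _ (1 * 0 + p.1.1) sf).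
apply: (is_derive_eq (is_deriveM (is_derive_cst (g p.1.2 * h p.2) (0 : R) 1)
  (is_derive_affine _ _ _ _ _ d))); rewrite /prod3 /GRing.scale/= !mulr0 addr0 add0r mul1r.
by rewrite -mulrA mulrC.
Qed.

Lemma is_derive_prod3_1 f g h p : smooth1 g ->
  is_derive p (basis3 R (lift ord0 ord0)) (prod3 f g h)
    (prod3 f (derive1 g) h p).
Proof.
move=> sg; apply: (@is_derive_line _
  (cst (f p.1.1 * h p.2) * (fun t => g (1 * t + p.1.2)))).
  move=> t; rewrite /prod3 /basis3 mulrfctE/= !mul1r.
  by rewrite /GRing.scale/= !mulr1 !mulr0 !add0r mulrAC.
have d := is_derive_derive1 _ _ (smooth1_derivable _ (1 * 0 + p.1.2) sg).
apply: (is_derive_eq (is_deriveM (is_derive_cst (f p.1.1 * h p.2) (0 : R) 1)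
  (is_derive_affine _ _ _ _ _ d))); rewrite /prod3 /GRing.scale/= !mulr0 addr0 add0r mul1r.
by rewrite mulrAC.
Qed.

Lemma is_derive_prod3_2 f g h p : smooth1 h ->
  is_derive p (basis3 R (lift ord0 (lift ord0 ord0))) (prod3 f g h)
    (prod3 f g (derive1 h) p).
Proof.
move=> sh; apply: (@is_derive_line _
  (cst (f p.1.1 * g p.1.2) * (fun t => h (1 * t + p.2)))).
  move=> t; rewrite /prod3 /basis3 mulrfctE/= !mul1r.
  by rewrite /GRing.scale/= !mulr1 !mulr0 !add0r.
have d := is_derive_derive1 _ _ (smooth1_derivable _ (1 * 0 + p.2) sh).
by apply: (is_derive_eq (is_deriveM (is_derive_cst (f p.1.1 * g p.1.2) (0 : R) 1)
  (is_derive_affine _ _ _ _ _ d))); rewrite /prod3 /GRing.scale/= !mulr0 addr0 add0r mul1r.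
Qed.

Lemma partial_prod3_0 f g h : smooth1 f ->
  partial ord0 (prod3 f g h) = prod3 (derive1 f) g h.
Proof.
by move=> sf; apply/funext => p; have [_ <-] := is_derive_prod3_0 f g h p sf.
Qed.

Lemma partial_prod3_1 f g h : smooth1 g ->
  partial (lift ord0 ord0) (prod3 f g h) = prod3 f (derive1 g) h.
Proof.
by move=> sg; apply/funext => p; have [_ <-] := is_derive_prod3_1 f g h p sg.
Qed.

Lemma partial_prod3_2 f g h : smooth1 h ->
  partial (lift ord0 (lift ord0 ord0)) (prod3 f g h) = prod3 f g (derive1 h).
Proof.
by move=> sh; apply/funext => p; have [_ <-] := is_derive_prod3_2 f g h p sh.
Qed.

(** Presents the three indices in the form that [big_ord_recl] produces for the Laplacian. *)
Lemma ord3_case (P : 'I_3 -> Prop) :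
  P ord0 -> P (lift ord0 ord0) -> P (lift ord0 (lift ord0 ord0)) -> forall i, P i.
Proof.
move=> P0 P1 P2 [[|[|[|//]]] i3].
- by rewrite (_ : Ordinal i3 = ord0)//; exact: val_inj.
- by rewrite (_ : Ordinal i3 = lift ord0 ord0)//; exact: val_inj.
- by rewrite (_ : Ordinal i3 = lift ord0 (lift ord0 ord0))//; exact: val_inj.
Qed.

Lemma continuous_prod3 f g h : continuous f -> continuous g -> continuous h ->
  continuous (prod3 f g h).
Proof.
move=> cf cg ch p; apply: cvgM; first apply: cvgM.
- apply: (@continuous_comp _ _ _ (fun p : R3 R => p.1.1) f); last exact: cf.
  by apply: (@continuous_comp _ _ _ (fun p : R3 R => p.1) fst); exact: cvg_fst.
- apply: (@continuous_comp _ _ _ (fun p : R3 R => p.1.2) g); last exact: cg.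
  apply: (@continuous_comp _ _ _ (fun p : R3 R => p.1) snd);
    [exact: cvg_fst|exact: cvg_snd].
- by apply: (@continuous_comp _ _ _ (fun p : R3 R => p.2) h);
    [exact: cvg_snd|exact: ch].
Qed.

(** Products of smooth one-variable factors are stable under each partial derivative, so every word
    of derivatives yields such a product again. *)
Lemma smooth_prod3 f g h : smooth1 f -> smooth1 g -> smooth1 h ->
  smooth (prod3 f g h).
Proof.
move=> sf sg sh w /=.
have [f' [g' [h' [-> sf' sg' sh']]]] : exists f' g' h',
    [/\ foldr (@partial R) (prod3 f g h) w = prod3 f' g' h',
        smooth1 f', smooth1 g' & smooth1 h'].
  elim: w => [|i w [f' [g' [h' [/= -> sf' sg' sh']]]]]; first by exists f, g, h.
  elim/ord3_case: i.
  - exists (derive1 f'), g', h'; split=> //; last exact: smooth1_derive1.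
    exact: partial_prod3_0.
  - exists f', (derive1 g'), h'; split=> //; last exact: smooth1_derive1.
    exact: partial_prod3_1.
  - exists f', g', (derive1 h'); split=> //; last exact: smooth1_derive1.
    exact: partial_prod3_2.
split; first by apply: continuous_prod3; exact: smooth1_continuous.
move=> i p; elim/ord3_case: i.
- by have [] := is_derive_prod3_0 f' g' h' p sf'.
- by have [] := is_derive_prod3_1 f' g' h' p sg'.
- by have [] := is_derive_prod3_2 f' g' h' p sh'.
Qed.

Definition box3 (A B C : R) : set (R3 R) := `[- A, A] `*` `[- B, B] `*` `[- C, C].

Lemma box3P A B C p :
  box3 A B C p <-> [/\ `|p.1.1| <= A, `|p.1.2| <= B & `|p.2| <= C].
Proof.
rewrite /box3/= !in_itv/= -!ler_norml; split; first by move=> [[]].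
by move=> [].
Qed.

Lemma prod3_eq0_outside f g h A B C p :
  (forall x, A < `|x| -> f x = 0) -> (forall x, B < `|x| -> g x = 0) ->
  (forall x, C < `|x| -> h x = 0) -> ~ box3 A B C p -> prod3 f g h p = 0.
Proof.
move=> f0 g0 h0 /box3P pN; rewrite /prod3.
have [p1|/f0->] := leP `|p.1.1| A; last by rewrite !mul0r.
have [p2|/g0->] := leP `|p.1.2| B; last by rewrite mulr0 mul0r.
by have [p3|/h0->] := leP `|p.2| C; [case: pN|rewrite mulr0].
Qed.

Lemma test_function_prod3 f g h A B C :
  smooth1 f -> smooth1 g -> smooth1 h ->
  (forall x, A < `|x| -> f x = 0) -> (forall x, B < `|x| -> g x = 0) ->
  (forall x, C < `|x| -> h x = 0) -> test_function (prod3 f g h).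
Proof.
move=> sf sg sh f0 g0 h0; split; first exact: smooth_prod3.
have box_compact : compact (box3 A B C).
  by apply: compact_setX; [apply: compact_setX|]; exact: segment_compact.
apply: (subclosed_compact (@closed_closure _ _) box_compact).
have box_closed : closed (box3 A B C).
  by apply: compact_closed => //; exact: norm_hausdorff.
rewrite [X in _ `<=` X](closure_id _).1//; apply: closure_subset => p /=.
by move=> /eqP pn0; apply: contrapT => /(prod3_eq0_outside f g h A B C p f0 g0 h0).
Qed.

Lemma laplacianE (F : R3 R -> R) : laplacian F =
  partial ord0 (partial ord0 F) +
  partial (lift ord0 ord0) (partial (lift ord0 ord0) F) +
  partial (lift ord0 (lift ord0 ord0)) (partial (lift ord0 (lift ord0 ord0)) F).
Proof.
apply/funext => p; rewrite /laplacian 3!big_ord_recl big_ord0.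
by rewrite [X in _ + (_ + X)]addr0 [LHS]addrA.
Qed.

Lemma partial_laplacian_prod3 f g h : smooth1 f -> smooth1 g -> smooth1 h ->
  partial ord0 (laplacian (prod3 f g h)) = fun p =>
    prod3 (derive1n 3 f) g h p + prod3 (derive1 f) (derive1n 2 g) h p +
    prod3 (derive1 f) g (derive1n 2 h) p.
Proof.
move=> sf sg sh.
have -> : laplacian (prod3 f g h) = prod3 (derive1n 2 f) g h +
    prod3 f (derive1n 2 g) h + prod3 f g (derive1n 2 h).
  rewrite laplacianE.
  rewrite (partial_prod3_0 f)// (partial_prod3_0 (derive1 f)); last exact: smooth1_derive1.
  rewrite (partial_prod3_1 f g)// (partial_prod3_1 f (derive1 g)); last exact: smooth1_derive1.
  by rewrite (partial_prod3_2 f g h)// (partial_prod3_2 f g (derive1 h))//;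
    exact: smooth1_derive1.
apply/funext => p; rewrite /partial.
have d1 := is_derive_prod3_0 (derive1n 2 f) g h p (smooth1_derive1n 2 _ sf).
have d2 := is_derive_prod3_0 f (derive1n 2 g) h p sf.
have d3 := is_derive_prod3_0 f g (derive1n 2 h) p sf.
by have [_ ->] := is_deriveD (is_deriveD d1 d2) d3.
Qed.

End ProductFunctions.

(** * Integral estimates for pairings with square integrable functions *)

Section Integrals.
Context {R : realType}.
Implicit Types (f g : R3 R -> R) (S : set (R3 R)).
Local Notation mu := (@leb3 R).

Lemma measurable_prod3 (f g h : R -> R) :
  continuous f -> continuous g -> continuous h ->
  measurable_fun setT (prod3 f g h).
Proof.
move=> cf cg ch; apply: measurable_funM; first apply: measurable_funM.
- apply: (measurableT_comp (continuous_measurable_fun cf)).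
  exact: measurableT_comp.
- apply: (measurableT_comp (continuous_measurable_fun cg)).
  exact: measurableT_comp.
- exact: (measurableT_comp (continuous_measurable_fun ch)).
Qed.

Lemma measurable_box3 (A B C : R) : measurable (box3 A B C).
Proof. by apply: measurableX => //; apply: measurableX. Qed.

Lemma leb3_box3 (A B C : R) : 0 <= A -> 0 <= B -> 0 <= C ->
  mu (box3 A B C) = (8 * (A * B * C))%:E.
Proof.
move=> A0 B0 C0.
pose I r : set (measurableTypeR R) := `[- r, r]%classic.
have mI r : measurable (I r) by exact: measurable_itv.
have mAB : measurable (I A `*` I B) by exact: measurableX.
transitivity (lebesgue_measure (I A) * lebesgue_measure (I B) *
    lebesgue_measure (I C))%E.
  rewrite /leb3 /box3; etransitivity; first exact: product_measure1E.
  by congr (_ * _)%E; exact: product_measure1E.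
have itvE (r : R) : 0 <= r -> lebesgue_measure (I r) = (2 * r)%:E.
  move=> r0; rewrite /I lebesgue_measure_itv/= lte_fin.
  have [r0'|] := ltP (- r) r; first by rewrite -EFinB; congr EFin; ring.
  move=> r1; have -> : r = 0 by lra.
  by rewrite mulr0.
by rewrite !itvE// -!EFinM; congr EFin; ring.
Qed.

Definition mass f : R := \int[mu]_p (f p ^+ 2).

Lemma inL2_measurable f : inL2 f -> measurable_fun setT f.
Proof. by case/andP; rewrite inE. Qed.

Lemma mass_ge0 f : 0 <= mass f.
Proof. by apply: Rintegral_ge0 => p _; exact: sqr_ge0. Qed.

(** In the extended reals the integral of the square is the square of the norm; [mass] is its real
    part, so conservation of the norm carries over. *)
Lemma eq_mass f g : L2norm f = L2norm g -> mass f = mass g.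
Proof.
move=> fg; rewrite /mass /Rintegral.
have E k : (\int[mu]_p ((k p ^+ 2)%:E) = L2norm k `^ 2)%E.
  rewrite /L2norm powR_Lnorm//; apply: eq_integral => p _ /=.
  by rewrite powR_mulrn// real_normK// num_real.
by rewrite !E fg.
Qed.

(** Young's inequality |f| <= l f^2 + 1/l on [S], multiplied by [D], gives one integrable majorant
    for both claims. When [V] is a multiple of l^2, both terms of the bound are multiples of [l], as
    in the Cauchy-Schwarz inequality. *)
Lemma pairing_dominated f g S V D l : inL2 f -> measurable_fun setT g ->
  measurable S -> mu S = V%:E -> 0 <= D -> 0 < l ->
  (forall p, `|g p| <= D) -> (forall p, ~ S p -> g p = 0) ->
  mu.-integrable setT (EFin \o (fun p => f p * g p)) /\
  `|\int[mu]_p (f p * g p)| <= D * (l * mass f + V / l).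
Proof.
move=> fL2 mg mS SV D0 l0 gD gS.
have mf := inL2_measurable f fL2.
have if2 := Lfun2_integrable_sqr fL2.
have iS : mu.-integrable setT (EFin \o (\1_S : R3 R -> R)).
  apply/integrableP; split; first exact/measurable_EFinP/measurable_indic.
  under eq_integral do rewrite /= ger0_norm//.
  by rewrite integral_indic// setIT [X in (X < _)%E]SV ltry.
have il : mu.-integrable setT (EFin \o (fun p => l * f p ^+ 2)).
  exact: (integrableZl measurableT l if2).
have il' : mu.-integrable setT (EFin \o (fun p => l^-1 * \1_S p)).
  exact: (integrableZl measurableT l^-1 iS).
have isum : mu.-integrable setT (EFin \o (fun p => l * f p ^+ 2 + l^-1 * \1_S p)).
  exact: (integrableD measurableT il il').
pose dom p := D * (l * f p ^+ 2 + l^-1 * \1_S p).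
have idom : mu.-integrable setT (EFin \o dom).
  exact: (integrableZl measurableT D isum).
have le_dom p : `|f p * g p| <= dom p.
  have [pS|pS] := pselect (S p); last first.
    rewrite gS// mulr0 normr0; apply: mulr_ge0 => //.
    by apply: addr_ge0; apply: mulr_ge0; rewrite ?sqr_ge0 ?invr_ge0 ?(ltW l0)//.
  rewrite normrM mulrC ler_pM// indicE mem_set// mulr1.
  rewrite -(ler_pM2l l0) mulrDr mulfV ?gt_eqF//.
  rewrite -[f p ^+ 2]real_normK ?num_real//.
  (* Expanding the square gives 2 l |f| <= l^2 f^2 + 1, which is stronger than what is asked. *)
  by have := sqr_ge0 (l * `|f p| - 1); nra.
have ifg : mu.-integrable setT (EFin \o (fun p => f p * g p)).
  apply: (le_integrable measurableT _ _ idom).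
    by apply/measurable_EFinP; exact: measurable_funM.
  move=> p _; rewrite /= lee_fin (le_trans (le_dom p))//.
  exact: ler_norm.
split=> //; apply: le_trans (le_normr_Rintegral measurableT ifg) _.
apply: le_trans (le_Rintegral measurableT _ idom (fun p _ => le_dom p)) _.
  exact: integrable_norm.
rewrite /dom RintegralZl// RintegralD// RintegralZl// RintegralZl//.
rewrite [X in l^-1 * X](_ : _ = V); first by rewrite [l^-1 * V]mulrC.
by rewrite /Rintegral integral_indic// setIT [X in fine X]SV.
Qed.

(** Pointwise, [g] is at least a 1_S - e; multiply by f^2 and integrate. The bound [D] serves the
    integrability of f^2 g. *)
Lemma square_pairing_ge f g S a e D : inL2 f -> measurable_fun setT g ->
  measurable S -> (forall p, `|g p| <= D) ->
  (forall p, S p -> a - e <= g p) -> (forall p, - e <= g p) ->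
  a * (\int[mu]_(p in S) (f p ^+ 2)) - e * mass f <=
  \int[mu]_p (f p ^+ 2 * g p).
Proof.
move=> fL2 mg mS gD ga ge.
have mf := inL2_measurable f fL2.
have if2 := Lfun2_integrable_sqr fL2.
have ifS : mu.-integrable setT (EFin \o (fun p => f p ^+ 2 * \1_S p)).
  apply: (le_integrable measurableT _ _ if2).
    by apply/measurable_EFinP; apply: measurable_funM;
      [exact: measurable_funX|exact: measurable_indic].
  move=> p _; rewrite /= lee_fin normrM ler_piMr//.
  by rewrite indicE; case: (p \in S); rewrite ?normr1 ?normr0.
have ifg : mu.-integrable setT (EFin \o (fun p => f p ^+ 2 * g p)).
  have iD : mu.-integrable setT (EFin \o (fun p => D * f p ^+ 2)).
    exact: (integrableZl measurableT D if2).
  apply: (le_integrable measurableT _ _ iD).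
    by apply/measurable_EFinP; apply: measurable_funM => //; exact: measurable_funX.
  move=> p _; rewrite /= lee_fin !normrM mulrC ler_wpM2r//.
  by rewrite (le_trans (gD p))// ler_norm.
have -> : \int[mu]_(p in S) (f p ^+ 2) = \int[mu]_p (f p ^+ 2 * \1_S p).
  rewrite Rintegral_mkcond; apply: eq_Rintegral => p _.
  by rewrite patchE indicE; case: (p \in S); rewrite ?mulr1 ?mulr0.
have iaS : mu.-integrable setT (EFin \o (fun p => a * (f p ^+ 2 * \1_S p))).
  exact: (integrableZl measurableT a ifS).
have ief : mu.-integrable setT (EFin \o (fun p => e * f p ^+ 2)).
  exact: (integrableZl measurableT e if2).
rewrite /mass -!RintegralZl// -RintegralB//.
apply: le_Rintegral => //; first exact: (integrableB measurableT iaS ief).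
move=> p _; rewrite indicE; have [/set_mem Sp|nSp] := boolP (p \in S).
  by rewrite mulr1 -mulrBl mulrC ler_wpM2l ?sqr_ge0// ga.
by rewrite !mulr0 sub0r -mulNr mulrC ler_wpM2l ?sqr_ge0.
Qed.

End Integrals.

(** * Test functions at three independent scales, with constants uniform in the scales *)

Section TestFamily.
Context {R : realType}.
Implicit Types (f g h : R -> R) (p : R3 R).

Lemma derive1n_scale n f (a : R) : smooth1 f ->
  derive1n n (fun x => f (a * x)) = (fun x => a ^+ n * derive1n n f (a * x)).
Proof.
move=> sf; elim: n => [|n IH]; first by apply/funext => x; rewrite mul1r.
rewrite /derive1n iterS -/(derive1n n _) IH; apply/funext => x.
have sn := smooth1_derive1n n _ sf.
have d := is_derive_derive1 _ _ (smooth1_derivable _ x (smooth1_scale _ a sn)).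
rewrite derive1_scale// in d.
have [_ E] := is_deriveZ (a ^+ n) d.
by rewrite derive1E [LHS]E /GRing.scale/= exprSr mulrA.
Qed.

Lemma derive1n_bounded f (A : R) N : 0 <= A -> smooth1 f ->
  (forall x, A < `|x| -> f x = 0) ->
  exists2 M, 0 <= M & forall n x, (n <= N)%N -> `|derive1n n f x| <= M.
Proof.
move=> A0 sf f0; elim: N => [|N [M M0 fM]].
  have [M M0 fM] := bounded_of_eq0_outside _ _ A0 (smooth1_continuous _ sf) f0.
  by exists M => // n x; rewrite leqn0 => /eqP ->; exact: fM.
have [M' M'0 fM'] := bounded_of_eq0_outside _ _ A0
  (smooth1_continuous _ (smooth1_derive1n N.+1 _ sf))
  (derive1n_eq0_outside N.+1 _ _ f0).
exists (M + M'); first exact: addr_ge0.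
move=> n x; rewrite leq_eqVlt ltnS => /predU1P[->|nN].
  by rewrite (le_trans (fM' x))// lerDr.
by rewrite (le_trans (fM n x nN))// lerDl.
Qed.

Lemma prod3_bounded f g h (a b c : R) p :
  (forall x, `|f x| <= a) -> (forall x, `|g x| <= b) -> (forall x, `|h x| <= c) ->
  `|prod3 f g h p| <= a * b * c.
Proof.
by move=> fa gb hc; rewrite /prod3 !normrM; do 2 apply: ler_pM => //.
Qed.

(** The order of quantifiers is the point: [m] is chosen before [e], and [A], [C] before the scales,
    so the box may grow with fixed constants. The [a1], [a2], [a3] are inverse side lengths; each
    derivative in a variable costs one factor of its scale. *)
Lemma exists_test_functions : exists2 m : R, 0 < m & forall e, 0 < e ->
  exists A C : R, [/\ 0 < A, 0 <= C & forall a1 a2 a3 : R,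
    0 < a1 -> 0 < a2 -> 0 < a3 -> exists phi : R3 R -> R,
    let B := box3 (A / a1) (A / a2) (A / a3) in
    let d3 := partial ord0 (laplacian phi) in
    [/\ test_function phi,
        [/\ measurable_fun setT phi, forall p, `|phi p| <= C &
            forall p, ~ B p -> phi p = 0],
        [/\ measurable_fun setT d3,
            forall p, `|d3 p| <= a1 * C * (a1 ^+ 2 + a2 ^+ 2 + a3 ^+ 2) &
            forall p, ~ B p -> d3 p = 0] &
        [/\ measurable_fun setT (partial ord0 phi),
            forall p, `|partial ord0 phi p| <= a1 * C,
            forall p, box3 a1^-1 a2^-1 a3^-1 p -> a1 * m <= partial ord0 phi p &
            forall p, - (a1 * e) <= partial ord0 phi p] ] ].
Proof.
have [chi [schi chi0 chi1 [mc mc0 mchi]]] := @exists_bump R.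
have [m m0 profile] := @exists_profile R.
(* The dilation by 2 carries the lower bound of [chi] from [-1/2, 1/2] to [-1, 1]. *)
pose rho := fun x => chi (2^-1 * x).
have srho : smooth1 rho by exact: smooth1_scale.
have rho0 x : 0 <= rho x by exact: chi0.
have rho2 x : 2 < `|x| -> rho x = 0.
  by move=> x2; apply: chi1; rewrite normrM ger0_norm ?invr_ge0//; lra.
have rhom x : `|x| <= 1 -> mc <= rho x.
  by move=> x1; apply: mchi; rewrite normrM ger0_norm ?invr_ge0//; lra.
have [Cr Cr0 rhoC] := derive1n_bounded rho 2 2 (ler0n _ 2) srho rho2.
exists (m / 2 * mc * mc); first by rewrite !mulr_gt0.
(* The first bound leaves psi' >= m / 2 on [-1, 1]; the second absorbs the factor rho rho <= Cr^2
   that multiplies the negative part of psi'. The + 1 keeps the denominator positive. *)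
move=> e e0; pose e' := Num.min (m / 2) (e / (Cr * Cr + 1)).
have e'0 : 0 < e' by rewrite lt_min !divr_gt0// ltr_wpDl// mulr_ge0.
have e'm : e' <= m / 2 by rewrite ge_min lexx.
have e'e : e' * (Cr * Cr) <= e.
  have : e' <= e / (Cr * Cr + 1) by rewrite ge_min lexx orbT.
  rewrite ler_pdivlMr ?ltr_wpDl ?mulr_ge0// mulrDr mulr1.
  by apply: le_trans; rewrite lerDl ltW.
have [psi [A' A'0 [spsi psiA psim psie]]] := profile _ e'0.
(* The operator d_x Delta takes up to three derivatives in x, but at most two in y or z. *)
have [Cp Cp0 psiC] := derive1n_bounded psi A' 3 A'0 spsi psiA.
pose A := A' + 2; have A0 : 0 < A by rewrite ltr_wpDl.
have psi_supp x : A < `|x| -> psi x = 0.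
  by move=> Ax; apply: psiA; rewrite (le_lt_trans _ Ax)// lerDl.
have rho_supp x : A < `|x| -> rho x = 0.
  by move=> Ax; apply: rho2; rewrite (le_lt_trans _ Ax)// lerDr.
exists A, (Cp * Cr * Cr); split=> //; first by rewrite !mulr_ge0.
move=> a1 a2 a3 a10 a20 a30.
pose f x := psi (a1 * x); pose g y := rho (a2 * y); pose h z := rho (a3 * z).
have sf : smooth1 f by exact: smooth1_scale.
have sg : smooth1 g by exact: smooth1_scale.
have sh : smooth1 h by exact: smooth1_scale.
have supp k a x : 0 < a -> (forall y, A < `|y| -> k y = 0) ->
    A / a < `|x| -> k (a * x) = 0 :> R.
  move=> a0 k0 ax; apply: k0; rewrite normrM gtr0_norm// mulrC.
  by rewrite -ltr_pdivrMr.
have f_supp x : A / a1 < `|x| -> f x = 0 by exact: supp.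
have g_supp x : A / a2 < `|x| -> g x = 0 by exact: supp.
have h_supp x : A / a3 < `|x| -> h x = 0 by exact: supp.
have bd (k : R -> R) (a M : R) n N : 0 < a -> smooth1 k -> (n <= N)%N ->
    (forall n x, (n <= N)%N -> `|derive1n n k x| <= M) ->
    forall x, `|derive1n n (fun x => k (a * x)) x| <= a ^+ n * M.
  move=> a0 sk nN kM x; rewrite derive1n_scale// normrM.
  by rewrite ger0_norm ?exprn_ge0 ?(ltW a0)// ler_wpM2l ?exprn_ge0 ?(ltW a0)// kM.
have fC n x : (n <= 3)%N -> `|derive1n n f x| <= a1 ^+ n * Cp.
  by move=> n3; exact: (bd psi a1 Cp n 3 a10 spsi n3 psiC).
have gC n x : (n <= 2)%N -> `|derive1n n g x| <= a2 ^+ n * Cr.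
  by move=> n2; exact: (bd rho a2 Cr n 2 a20 srho n2 rhoC).
have hC n x : (n <= 2)%N -> `|derive1n n h x| <= a3 ^+ n * Cr.
  by move=> n2; exact: (bd rho a3 Cr n 2 a30 srho n2 rhoC).
have c0 (k : R -> R) : smooth1 k -> continuous k by exact: smooth1_continuous.
have sn (k : R -> R) n : smooth1 k -> smooth1 (derive1n n k).
  exact: smooth1_derive1n.
exists (prod3 f g h) => /=; rewrite partial_laplacian_prod3// partial_prod3_0//.
have d0 := derive1n_eq0_outside.
split.
- exact: (test_function_prod3 f g h _ _ _ sf sg sh f_supp g_supp h_supp).
- split.
  + by apply: measurable_prod3; exact: smooth1_continuous.
  + move=> p; apply: prod3_bounded => x.
    * by have := fC 0 x isT; rewrite mul1r.
    * by have := gC 0 x isT; rewrite mul1r.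
    * by have := hC 0 x isT; rewrite mul1r.
  + by move=> p; exact: (prod3_eq0_outside f g h _ _ _ p f_supp g_supp h_supp).
- split.
  + apply: measurable_funD; first apply: measurable_funD.
    * exact: (measurable_prod3 _ _ _ (c0 _ (sn _ 3 sf)) (c0 _ sg) (c0 _ sh)).
    * exact: (measurable_prod3 _ _ _ (c0 _ (sn _ 1 sf)) (c0 _ (sn _ 2 sg)) (c0 _ sh)).
    * exact: (measurable_prod3 _ _ _ (c0 _ (sn _ 1 sf)) (c0 _ sg) (c0 _ (sn _ 2 sh))).
  + move=> p.
    (* The bound splits into one product of factor bounds for each of the three terms of d_x
       Delta. *)
    have E : a1 * (Cp * Cr * Cr) * (a1 ^+ 2 + a2 ^+ 2 + a3 ^+ 2) =
      (a1 ^+ 3 * Cp) * (a2 ^+ 0 * Cr) * (a3 ^+ 0 * Cr) +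
      (a1 ^+ 1 * Cp) * (a2 ^+ 2 * Cr) * (a3 ^+ 0 * Cr) +
      (a1 ^+ 1 * Cp) * (a2 ^+ 0 * Cr) * (a3 ^+ 2 * Cr) by ring.
    rewrite E; apply: le_trans (ler_normD _ _) _; apply: lerD.
      apply: le_trans (ler_normD _ _) _; apply: lerD; apply: prod3_bounded => x.
      * exact: fC.
      * exact: (gC 0).
      * exact: (hC 0).
      * exact: (fC 1).
      * exact: gC.
      * exact: (hC 0).
    apply: prod3_bounded => x; [exact: (fC 1)|exact: (gC 0)|exact: hC].
  + move=> p Bp.
    rewrite (prod3_eq0_outside _ _ _ _ _ _ p (d0 _ 3 _ _ f_supp) g_supp h_supp)//.
    rewrite (prod3_eq0_outside _ _ _ _ _ _ p (d0 _ 1 _ _ f_supp) (d0 _ 2 _ _ g_supp) h_supp)//.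
    rewrite (prod3_eq0_outside _ _ _ _ _ _ p (d0 _ 1 _ _ f_supp) g_supp (d0 _ 2 _ _ h_supp))//.
    by rewrite !addr0.
- have df x : derive1 f x = a1 * derive1 psi (a1 * x) by rewrite derive1_scale.
  split.
  + exact: (measurable_prod3 _ _ _ (c0 _ (sn _ 1 sf)) (c0 _ sg) (c0 _ sh)).
  + move=> p; have -> : a1 * (Cp * Cr * Cr) =
      (a1 ^+ 1 * Cp) * (a2 ^+ 0 * Cr) * (a3 ^+ 0 * Cr) by ring.
    by apply: prod3_bounded => x; [exact: (fC 1)|exact: (gC 0)|exact: (hC 0)].
  + move=> p /box3P[p1 p2 p3]; rewrite /prod3 df -!mulrA ler_pM2l// !mulrA.
    have le1 (a x : R) : 0 < a -> `|x| <= a^-1 -> `|a * x| <= 1.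
      by move=> a0 xa; rewrite normrM gtr0_norm// -ler_pdivlMl// mulr1.
    have [m20 mc0'] : 0 <= m / 2 /\ 0 <= mc by rewrite !ltW ?divr_gt0.
    apply: ler_pM; [exact: mulr_ge0|exact: mc0'| |exact/rhom/le1].
    apply: ler_pM; [exact: m20|exact: mc0'| |exact/rhom/le1].
    by apply: le_trans (psim _ (le1 _ _ a10 p1)); lra.
  + move=> p; rewrite /prod3 df -!mulrA -mulrN ler_pM2l//.
    have r01 x : 0 <= rho x <= Cr.
      rewrite rho0/=; apply: le_trans (ler_norm _) _.
      exact: (rhoC 0%N).
    have /andP[G0 GC] := r01 (a2 * p.1.2); have /andP[H0 HC] := r01 (a3 * p.2).
    have GH : rho (a2 * p.1.2) * rho (a3 * p.2) <= Cr * Cr by exact: ler_pM.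
    have GH0 : 0 <= rho (a2 * p.1.2) * rho (a3 * p.2) by exact: mulr_ge0.
    have := psie (a1 * p.1.1); rewrite /g /h.
    move: (rho _ * rho _) GH GH0 => w w1 w0.
    move: (derive1 psi _) => d dlow.
    apply: (@le_trans _ _ (- e' * w)); last by rewrite ler_wpM2r.
    by rewrite mulNr lerN2 (le_trans _ e'e)// ler_wpM2l// ltW.
Qed.

End TestFamily.

(** * Decay of the local mass along a sequence of times *)

Section LocalDecay.
Context {R : realType}.
Local Notation mu := (@leb3 R).

(* The pairings with u are estimated by Young's inequality, with weight l, on the
   support of the test function, whose volume is a multiple of l^2. *)
Lemma ZK_local_mass_bound (u0 : R3 R -> R) (u : R -> R3 R -> R) :
  ZK_solution u0 u -> exists2 m : R, 0 < m & forall e, 0 < e ->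
  exists2 K : R, 0 <= K & forall T L1 L2 L3 l : R,
    0 < T -> 0 < L1 -> 0 < L2 -> 0 < L3 -> 0 < l -> l ^+ 2 = L1 * L2 * L3 ->
  exists t, [/\ T < t, t < 2 * T &
    m * \int[mu]_(p in box3 L1 L2 L3) (u t p ^+ 2) <=
    e + K * (l * (L1 / T + (L1 ^- 2 + L2 ^- 2 + L3 ^- 2)))].
Proof.
move=> uZK; have [m m0 tests] := @exists_test_functions R.
exists m => // e e0; pose M := mass u0.
have M0 : 0 <= M by exact: mass_ge0.
have uL2 t : inL2 (u t) by have [/(_ t)[]] := ZK_continuous uZK.
have uM t : mass (u t) = M by apply: eq_mass; exact: ZK_mass uZK t.
have M10 : 0 < M + 1 by rewrite ltr_wpDl.
(* With slope error e / (M + 1), the loss over the total mass [M] is at most [e], also when M =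
   0. *)
have [A [C [A0 C0 {}tests]]] := tests _ (divr_gt0 e0 M10).
have A30 : 0 <= 8 * (A * A * A) by rewrite !mulr_ge0// ltW.
(* Of the factor 4, one 2 counts the two endpoint values of the pairing and the other undoes the 1/2
   of the nonlinear term. *)
exists (4 * C * (M + 8 * (A * A * A))).
  by rewrite !mulr_ge0// addr_ge0.
move=> T L1 L2 L3 l T0 L10 L20 L30 l0 lE.
have [] := tests L1^-1 L2^-1 L3^-1; rewrite ?invr_gt0//.
move=> phi /=; rewrite !invrK => -[phi_test [mphi phiC phi0] [md3 d3C d30]
  [mdx dxC dxm dxe]].
have VB : mu (box3 (A * L1) (A * L2) (A * L3)) = (8 * (A * A * A) * l ^+ 2)%:E.
  by rewrite leb3_box3 ?mulr_ge0 ?ltW// lE; congr EFin; ring.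
have NE : l * M + 8 * (A * A * A) * l ^+ 2 / l = l * (M + 8 * (A * A * A)).
  by field; rewrite gt_eqF.
pose N := l * (M + 8 * (A * A * A)).
have N0 : 0 <= N by rewrite mulr_ge0 ?addr_ge0 ?(ltW l0).
have mB := measurable_box3 (A * L1) (A * L2) (A * L3).
pose F s := \int[mu]_p (u s p * phi p).
have FN s : `|F s| <= C * N.
  have [_] := pairing_dominated _ _ _ _ _ l (uL2 s) mphi mB VB C0 l0 phiC phi0.
  by rewrite uM NE.
pose S := L1^-1 ^+ 2 + L2^-1 ^+ 2 + L3^-1 ^+ 2.
have S0 : 0 <= S by rewrite !addr_ge0// exprn_ge0// invr_ge0 ltW.
have dF s := ZK_eq uZK phi_test s.
have T2T : T < 2 * T by lra.
have cF : {within `[T, 2 * T], continuous F}.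
  apply: continuous_subspaceT => s; apply: differentiable_continuous.
  by apply/derivable1_diffP; have [] := dF s.
(* At this [t] the right side of the equation equals (F(2T) - F(T)) / T, hence is at most 2 C N /
   T. *)
have [t tT FE] := MVT T2T (fun s _ => dF s) cF.
move: tT; rewrite in_itv/= => /andP[Tt t2T].
exists t; split=> //.
set J := \int[mu]_(p in box3 L1 L2 L3) (u t p ^+ 2).
have D0 : 0 <= L1^-1 * C * S by rewrite !mulr_ge0// invr_ge0 ltW.
have I3 : `|\int[mu]_p (u t p * partial ord0 (laplacian phi) p)| <=
    L1^-1 * C * S * N.
  have [_] := pairing_dominated _ _ _ _ _ l (uL2 t) md3 mB VB D0 l0 d3C d30.
  by rewrite uM NE.
have I1 : L1^-1 * (m * J - e / (M + 1) * M) <=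
    \int[mu]_p (u t p ^+ 2 * partial ord0 phi p).
  have mS := measurable_box3 L1 L2 L3.
  have a1e : 0 <= L1^-1 * (e / (M + 1)) by rewrite mulr_ge0 ?divr_ge0 ?invr_ge0 ?ltW.
  have dxm' p : box3 L1 L2 L3 p ->
      L1^-1 * m - L1^-1 * (e / (M + 1)) <= partial ord0 phi p.
    move=> Bp; apply: (@le_trans _ _ (L1^-1 * m)); last exact: dxm.
    by rewrite gerBl.
  have := square_pairing_ge _ _ _ _ _ _ (uL2 t) mdx mS dxC dxm' dxe.
  by rewrite uM -/J; apply: le_trans; rewrite mulrBr !mulrA.
have eM : e / (M + 1) * M <= e.
  by rewrite mulrAC ler_pdivrMr// ler_pM2l// lerDl.
have FT : F (2 * T) - F T <= 2 * C * N.
  have -> : 2 * C * N = C * N + C * N by ring.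
  apply: le_trans (ler_norm _) _; apply: le_trans (ler_normB _ _) _.
  exact: lerD.
rewrite !exprVn in S S0 D0 I3 *; rewrite -/S.
rewrite -lerBlDl; apply: le_trans (lerB (lexx _) eM) _.
rewrite -(ler_pM2l (_ : 0 < L1^-1)) ?invr_gt0//; apply: le_trans I1 _.
move: FE I3; rewrite /F -/(F _) -/(F T).
set i1 := \int[mu]_p (u t p ^+ 2 * _); set i3 := \int[mu]_p _ => FE.
rewrite ler_norml => /andP[i3l _].
have FE' : (i3 + 2^-1 * i1) * T <= 2 * C * N.
  apply: le_trans FT; rewrite FE.
  by have -> : 2 * T - T = T by ring.
have : i3 + 2^-1 * i1 <= 2 * C * N / T by rewrite ler_pdivlMr.
(* The dispersive term needs only half of its share; the larger constant gives both terms a common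
   factor. *)
have -> : L1^-1 * (4 * C * (M + 8 * (A * A * A)) * (l * (L1 / T + S))) =
    2 * (2 * C * N / T) + 2 * (2 * (L1^-1 * C * S * N)).
  by rewrite /N; field; rewrite !gt_eqF.
have : 0 <= L1^-1 * C * S * N by exact: mulr_ge0.
lra.
Qed.

Lemma powRN_small (g e : R) : 0 < g -> 0 < e ->
  exists2 N : R, 0 < N & forall s, N <= s -> s `^ (- g) <= e.
Proof.
move=> g0 e0; exists (e^-1 `^ g^-1); first by rewrite powR_gt0// invr_gt0.
move=> s Ns; have s0 : 0 < s by apply: lt_le_trans Ns; rewrite powR_gt0// invr_gt0.
rewrite powRN invf_ple ?posrE ?powR_gt0//.
have -> : e^-1 = (e^-1 `^ g^-1) `^ g.
  by rewrite -powRrM mulVf ?gt_eqF// powRr1// invr_ge0 ltW.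
by apply: ge0_ler_powR; rewrite ?nnegrE ?powR_ge0// ltW.
Qed.

Lemma measurable_Omega (b r1 r2 t : R) : measurable (Omega b r1 r2 t).
Proof.
have -> : Omega b r1 r2 t = `]- (t `^ b), t `^ b[ `*`
    `]- (t `^ (b * r1)), t `^ (b * r1)[ `*` `]- (t `^ (b * r2)), t `^ (b * r2)[.
  apply/seteqP; split => p /=; rewrite !in_itv/= -!ltr_norml.
    by case=> p1 p2 p3; split.
  by case=> -[p1 p2] p3; split.
by apply: measurableX => //; apply: measurableX.
Qed.

(** Apply the bound on [s/2, s] with the box of half-sides s^b, s^(b r1), s^(b r2), which contains
    Omega(t) for every t <= s. Then l = s^q and the error terms are powers of [s] with negative
    exponents. *)
Lemma ZK_liminf_local_mass (b r1 r2 : R) (u0 : R3 R -> R) (u : R -> R3 R -> R) :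
  0 < b -> 2^-1 < r1 -> 2^-1 < r2 -> r1 + r2 < 3 -> r1 + 1 < 3 * r2 ->
  r2 + 1 < 3 * r1 -> b < 2 / (3 + r1 + r2) -> ZK_solution u0 u ->
  forall e T0 : R, 0 < e -> exists2 t, T0 < t &
    (\int[mu]_(p in Omega b r1 r2 t) ((u t p ^+ 2)%:E) <= e%:E)%E.
Proof.
move=> b0 r1h r2h r12 r1r2 r2r1 bq uZK e T0 e0.
have [m m0 bound] := ZK_local_mass_bound _ _ uZK.
(* Half of the budget m e goes to the slope error, half to the powers of [s]. *)
have me2 : 0 < m * e / 2 by rewrite !divr_gt0// mulr_gt0.
have [K K0 {}bound] := bound _ me2.
pose q := b * (1 + r1 + r2) / 2.
(* Four powers of [s] are made at most [e1]; the first counts twice because T = s/2, whence 5. *)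
pose e1 := m * e / 2 / (5 * (K + 1)).
have K10 : 0 < K + 1 by rewrite ltr_wpDl.
have e10 : 0 < e1 by rewrite divr_gt0// mulr_gt0.
have bq' : b * (3 + r1 + r2) < 2 by rewrite -ltr_pdivlMr//; lra.
(* After division by b/2 for the last three, these are exactly b (3 + r1 + r2) < 2, r1 + r2 < 3, r2
   + 1 < 3 r1 and r1 + 1 < 3 r2. *)
have [g0 [g1 [g2 g3]]] : 0 < 1 - q - b /\ 0 < 2 * b - q /\
    0 < 2 * (b * r1) - q /\ 0 < 2 * (b * r2) - q.
  by rewrite /q; do ?split; nra.
have [N0 N00 P0] := powRN_small _ _ g0 e10.
have [N1 N10 P1] := powRN_small _ _ g1 e10.
have [N2 N20 P2] := powRN_small _ _ g2 e10.
have [N3 N30 P3] := powRN_small _ _ g3 e10.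
pose s := N0 + N1 + N2 + N3 + 2 * `|T0| + 1.
have T0s : T0 <= s / 2 by have := ler_norm T0; have := normr_ge0 T0; rewrite /s; lra.
have s0 : 0 < s by have := normr_ge0 T0; rewrite /s; lra.
have sN0 : N0 <= s by have := normr_ge0 T0; rewrite /s; lra.
have sN1 : N1 <= s by have := normr_ge0 T0; rewrite /s; lra.
have sN2 : N2 <= s by have := normr_ge0 T0; rewrite /s; lra.
have sN3 : N3 <= s by have := normr_ge0 T0; rewrite /s; lra.
have sn0 : s != 0 by rewrite gt_eqF.
have powD x y : s `^ (x + y) = s `^ x * s `^ y by rewrite powRD// sn0 implybT.
have [||||||t [st ts tJ]] := bound (s / 2) (s `^ b) (s `^ (b * r1)) (s `^ (b * r2)) (s `^ q).
- by rewrite divr_gt0.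
- exact: powR_gt0.
- exact: powR_gt0.
- exact: powR_gt0.
- exact: powR_gt0.
- by rewrite expr2 -!powD; congr (s `^ _); rewrite /q; field.
exists t; first exact: le_lt_trans st.
have {}ts : t <= s by rewrite ltW// (lt_le_trans ts)// mulrC divfK.
have t0 : 0 <= t by rewrite ltW// (lt_trans _ st)// divr_gt0.
have Omega_box : Omega b r1 r2 t `<=` box3 (s `^ b) (s `^ (b * r1)) (s `^ (b * r2)).
  have mono x : 0 < x -> t `^ x <= s `^ x.
    by move=> x0; apply: ge0_ler_powR; rewrite ?nnegrE// ltW.
  move=> p [p1 p2 p3]; apply/box3P; split.
  - by rewrite (le_trans (ltW p1))// mono.
  - by rewrite (le_trans (ltW p2))// mono// mulr_gt0//; lra.
  - by rewrite (le_trans (ltW p3))// mono// mulr_gt0//; lra.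
have uL2 : inL2 (u t) by have [/(_ t)[]] := ZK_continuous uZK.
have if2 := Lfun2_integrable_sqr uL2.
have mf2 : measurable_fun setT (fun p => u t p ^+ 2).
  by apply: measurable_funX; exact: inL2_measurable.
have mbox := measurable_box3 (s `^ b) (s `^ (b * r1)) (s `^ (b * r2)).
set B := box3 _ _ _ in tJ Omega_box mbox.
have le_box : (\int[mu]_(p in Omega b r1 r2 t) ((u t p ^+ 2)%:E) <=
    \int[mu]_(p in B) ((u t p ^+ 2)%:E))%E.
  apply: ge0_subset_integral => //.
  - exact: measurable_Omega.
  - by apply/measurable_EFinP; exact: measurable_funTS.
  - by move=> p _; rewrite lee_fin sqr_ge0.
apply: (le_trans le_box).
(* Finiteness identifies the extended integral with the real one bounded in [tJ]. *)
have finB : (\int[mu]_(p in B) ((u t p ^+ 2)%:E))%E \is a fin_num.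
  apply: integrable_fin_num => //; apply: integrableS if2 => //.
rewrite -(fineK finB) lee_fin -(ler_pM2l m0) -/(Rintegral _ _ _).
apply: (le_trans tJ).
have small : s `^ q * (s `^ b / (s / 2) +
    ((s `^ b) ^- 2 + (s `^ (b * r1)) ^- 2 + (s `^ (b * r2)) ^- 2)) <= 5 * e1.
  have inv2 x : (s `^ x) ^- 2 = s `^ (- (2 * x)).
    by rewrite powRN; congr _^-1; rewrite expr2 -powD; congr (s `^ _); ring.
  have -> : s `^ b / (s / 2) = 2 * (s `^ b * s `^ (- 1)).
    rewrite powRN powRr1 ?(ltW s0)//; field.
    by rewrite sn0.
  rewrite !inv2 !mulrDr mulrCA -!powD.
  have := P0 _ sN0; have := P1 _ sN1; have := P2 _ sN2; have := P3 _ sN3.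
  have -> : - (1 - q - b) = q + (b + - 1) by ring.
  have -> : - (2 * b - q) = q + - (2 * b) by ring.
  have -> : - (2 * (b * r1) - q) = q + - (2 * (b * r1)) by ring.
  have -> : - (2 * (b * r2) - q) = q + - (2 * (b * r2)) by ring.
  lra.
rewrite [leRHS](_ : _ = m * e / 2 + m * e / 2); last by field.
rewrite lerD2l; apply: (@le_trans _ _ (K * (5 * e1))); first by rewrite ler_wpM2l.
have -> : 5 * e1 = m * e / 2 / (K + 1) by rewrite /e1; field; rewrite gt_eqF.
by rewrite mulrA ler_pdivrMr// mulrC ler_pM2l// lerDl.
Qed.

Lemma ereal_inf_image_le0 (X : Type) (V : set X) (f : X -> \bar R) :
  (forall e : R, 0 < e -> exists2 x, V x & (f x <= e%:E)%E) ->
  (ereal_inf (f @` V) <= 0)%E.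
Proof.
move=> fV; apply/lee_addgt0Pr => e e0; rewrite add0e.
have [x Vx fx] := fV e e0.
by apply: le_trans fx; apply: ereal_inf_lbound; exists x.
Qed.

End LocalDecay.

Theorem mainTheorem7 (R : realType) (b r1 r2 : R)
  (b_gt0 : 0 < b) (r1_gt : 2^-1 < r1) (r2_gt : 2^-1 < r2)
  (r12 : r1 + r2 < 3) (r1r2 : r1 + 1 < 3 * r2) (r2r1 : r2 + 1 < 3 * r1)
  (b_lt : b < 2 / (3 + r1 + r2))
  (u0 : R3 R -> R) (u0H1 : inH1 u0)
  (u : R -> R3 R -> R) (uZK : ZK_solution u0 u) :
  limf_einf (fun t : R => \int[@leb3 R]_(p in Omega b r1 r2 t) ((u t p ^+ 2)%:E))%E
    (pinfty_nbhs R) = 0%E.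
Proof.
have small := ZK_liminf_local_mass _ _ _ _ _ b_gt0 r1_gt r2_gt r12 r1r2 r2r1 b_lt uZK.
rewrite limf_einfE; apply/eqP; rewrite eq_le; apply/andP; split.
  (* Upper bound: every neighbourhood of infinity contains a half-line, on which arbitrarily small
     local masses occur. *)
  apply: ge_ereal_sup => _ [V [T0 [_ TV]] <-].
  apply: ereal_inf_image_le0 => e e0.
  by have [t Tt te] := small e T0 e0; exists t => //; exact: TV.
(* Lower bound: the integrals are nonnegative, so the whole line already serves as neighbourhood. *)
apply: ereal_sup_ge; exists (ereal_inf
    ((fun t => \int[@leb3 R]_(p in Omega b r1 r2 t) ((u t p ^+ 2)%:E))%E @` setT)).
  by exists setT => //; exact: filterT.
apply: le_ereal_inf_tmp => _ [t _ <-].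
by apply: integral_ge0 => p _; rewrite lee_fin sqr_ge0.
Qed.
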